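(* Let $m$ be a positive integer, $r$ a nonnegative integer, $\lambda\in\mathbb{R}$. For integers $n\ge i\ge0$, $$W_{m,\lambda}^{(r)}(n,i)=\frac{1}{m^{i}\,i!}\sum_{k=0}^{i}\binom{i}{k}(-1)^{i-k}(mk+r)_{n,\lambda}.$$
   Context: $(x)_{0,\lambda}=1$, $(x)_{n,\lambda}=x(x-\lambda)\cdots(x-(n-1)\lambda)$, $(x)_n=(x)_{n,1}$. The degenerate $r$-Whitney numbers of the second kind are defined by the polynomial identities $(mx+r)_{n,\lambda}=\sum_{k=0}^n W_{m,\lambda}^{(r)}(n,k)m^k(x)_k$, $n\ge0$. *)

(* Defs.v *)
From HB Require Import structures.
From mathcomp Require Import all_boot all_order all_algebra.
From mathcomp Require Import reals ring.
Set Implicit Arguments.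
Unset Strict Implicit.
Unset Printing Implicit Defensive.
Import Order.TTheory GRing.Theory Num.Theory.
Local Open Scope ring_scope.

(* (x)_{n,lambda}; stated over any ring so that it applies both to real       *)
(* numbers and to polynomials. The ordinary (x)_n is [dfalling x 1 n].        *)
Definition dfalling (A : nzRingType) (x lambda : A) (n : nat) : A :=
  \prod_(j < n) (x - j%:R * lambda).

(* The defining identities, in {poly R}, with ['X] as the variable x. They    *)
(* constrain [W n k] only for [k <= n].                                       *)
Definition degenerate_rWhitney2 (R : realType) (m r : nat) (lambda : R)
    (W : nat -> nat -> R) : Prop :=
  forall n : nat,
    dfalling (m%:R * 'X + r%:R) lambda%:P n =
    \sum_(k < n.+1) (W n k * m%:R ^+ k) *: dfalling ('X : {poly R}) 1 k.

(* The definition above is not vacuous. *)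
Lemma degenerate_rWhitney2_exists (R : realType) (m r : nat) (lambda : R) :
  exists W, degenerate_rWhitney2 m r lambda W.
Proof.
pose step n (f : nat -> R) k :=
  (if k is k'.+1 then f k' else 0) + ((m * k + r)%:R - n%:R * lambda) * f k.
pose W := fix W n : nat -> R :=
  if n is n'.+1 then step n' (W n') else fun k => (k == 0%N)%:R.
have W0 n k : (n < k)%N -> W n k = 0.
  elim: n k => [|n IHn] [|k] //= lt_nk.
  by rewrite /step !IHn ?mulr0 ?addr0 // ltnW.
exists W; elim=> [|n IHn].
  by rewrite big_ord1 /dfalling !big_ord0 /= expr0 mulr1 scale1r.
have dS (A : nzRingType) (x l : A) k :
    dfalling x l k.+1 = dfalling x l k * (x - k%:R * l).
  by rewrite /dfalling big_ord_recr.
rewrite dS IHn mulr_suml.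
under [RHS]eq_bigr => k _ do rewrite /= /step mulrDl scalerDl.
rewrite big_split /= [X in _ = X + _]big_ord_recl /= mul0r scale0r add0r.
rewrite [X in _ = _ + X]big_ord_recr /= (W0 n n.+1) // mulr0 mul0r scale0r addr0.
rewrite -big_split /=; apply: eq_bigr => k _.
rewrite /bump /= add1n dS mulr1 exprS.
rewrite -!mul_polyC !(rmorphM, rmorphB, rmorphD, rmorphXn, rmorph_nat) /=.
ring.
Qed.

(* Main.v *)
Require Import Defs.
From mathcomp Require Import all_boot all_order all_algebra.
From mathcomp Require Import reals.
Import GRing.Theory Num.Theory.
Local Open Scope ring_scope.

(** Evaluating the defining polynomial identity at [x = k] gives
    [(mk+r)_{n,lambda} = \sum_j W(n,j) m^j j! 'C(k, j)], and binomial inversion,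
    read off the coefficients of ['X^i = (('X + 1) - 1)^i], recovers [W(n,i)]. *)

Lemma coefXD1n (A : comNzRingType) (k j : nat) :
  (('X + 1 : {poly A}) ^+ k)`_j = 'C(k, j)%:R.
Proof.
rewrite addrC exprDn coef_sum.
under eq_bigr do rewrite expr1n mul1r coefMn coefXn.
have [lt_jk|le_kj] := ltnP j k.+1.
  rewrite (bigD1 (Ordinal lt_jk)) //= eqxx big1 ?addr0 // => l ne_lj.
  (* Equality of ordinals is convertible to equality of their values. *)
  by rewrite eq_sym -[_ == _]/(l == Ordinal lt_jk) (negPf ne_lj) mul0rn.
rewrite bin_small // big1 // => l _.
by rewrite gtn_eqF ?mul0rn // (leq_trans (ltn_ord l)).
Qed.

Lemma sum_bin_bin_alternating (A : comNzRingType) (i j : nat) :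
  \sum_(k < i.+1) 'C(i, k)%:R * (-1) ^+ (i - k) * 'C(k, j)%:R = (j == i)%:R :> A.
Proof.
(* Writing ['X] as [-1 + ('X + 1)], in this order, makes [k] the exponent of ['X + 1]. *)
rewrite -(coefXn A i j) -['X](addrK 1) addrC exprDn coef_sum.
apply: eq_bigr => k _.
rewrite -(polyC1 A) -polyCN -polyC_exp coefMn coefCM polyC1 coefXD1n.
by rewrite -mulrA mulr_natl.
Qed.

Lemma dfalling_nat1 (A : nzRingType) (k j : nat) :
  dfalling (k%:R : A) 1 j = (k ^_ j)%:R.
Proof.
rewrite /dfalling; elim: j => [|j IHj]; first by rewrite big_ord0.
rewrite big_ord_recr /= IHj ffactnSr natrM mulr1.
(* For [j > k] the truncated [k - j] no longer matches the ring difference, but [k ^_ j] is already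
   zero. *)
have [le_jk|lt_kj] := leqP j k; first by rewrite natrB.
by rewrite ffact_small // !mul0r.
Qed.

Lemma horner_dfalling (A : comNzRingType) (p l : {poly A}) (n : nat) (x : A) :
  (dfalling p l n).[x] = dfalling p.[x] l.[x] n.
Proof.
rewrite /dfalling horner_prod; apply: eq_bigr => j _.
by rewrite hornerD hornerN hornerM -polyC_natr hornerC.
Qed.

(** Splitting [k ^_ j] as ['C(k, j) * j!] leaves [k] only in the binomial coefficient, the form that
    inversion acts on. *)
Lemma dfalling_rWhitney2 (R : realType) (m r : nat) (lambda : R)
    (W : nat -> nat -> R) (n k : nat) :
  degenerate_rWhitney2 m r lambda W ->
  dfalling ((m * k + r)%:R : R) lambda n =
  \sum_(j < n.+1) W n j * (m%:R ^+ j * j`!%:R) * 'C(k, j)%:R.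
Proof.
move=> /(_ n) /(congr1 (horner^~ k%:R)).
rewrite horner_dfalling hornerD hornerM -!polyC_natr !hornerC hornerX.
rewrite -natrM -natrD => ->; rewrite horner_sum; apply: eq_bigr => j _.
rewrite hornerZ horner_dfalling hornerX -polyC1 hornerC dfalling_nat1.
by rewrite -bin_ffact natrM mulrA -!mulrA [_ * j`!%:R]mulrC.
Qed.

Theorem theorem15 (R : realType) (m r : nat) (lambda : R)
    (W : nat -> nat -> R) (m_gt0 : (0 < m)%N)
    (defW : degenerate_rWhitney2 m r lambda W) (n i : nat) (le_in : (i <= n)%N) :
  W n i = (m%:R ^+ i * (i`!)%:R)^-1 *
    \sum_(k < i.+1)
      ('C(i, k))%:R * (-1) ^+ (i - k) * dfalling ((m * k + r)%:R : R) lambda n.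
Proof.
have nz : m%:R ^+ i * i`!%:R != 0 :> R.
  by rewrite mulf_neq0 ?expf_neq0 // pnatr_eq0 -lt0n ?fact_gt0.
apply: (mulfI nz); rewrite mulVKf //.
under eq_bigr do rewrite (dfalling_rWhitney2 _ _ _ _ _ _ _ defW) mulr_sumr.
(* With the sum over [k] innermost, orthogonality of binomials turns it into a Kronecker delta in
   [j] and [i]. *)
rewrite exchange_big /=.
under eq_bigr => j _.
  under eq_bigr do rewrite mulrCA.
  rewrite -mulr_sumr sum_bin_bin_alternating.
  over.
(* Since [i <= n], the index [i] occurs in the sum over [j], and only its term survives. *)
rewrite (bigD1 (Ordinal (le_in : (i < n.+1)%N))) //= eqxx mulr1 mulrC.
rewrite big1 ?addr0 // => j ne_ji.
by rewrite -[_ == _]/(j == Ordinal (le_in : (i < n.+1)%N)) (negPf ne_ji) mulr0.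
Qed.
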